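(* Let $S$ be a finite non-commutative inverse semigroup, and let $\mathcal{G}(S)$ be its commuting graph. If $\mathcal{G}(S)$ contains at least one cycle, then the girth of $\mathcal{G}(S)$ is equal to $3$.
   Context: A semigroup $S$ is an inverse semigroup if it is equipped with a unary operation $x\mapsto x^{-1}$ such that for all $x,y\in S$: $(x^{-1})^{-1}=x$, $xx^{-1}x=x$, $(xy)^{-1}=y^{-1}x^{-1}$, and $(xx^{-1})(yy^{-1})=(yy^{-1})(xx^{-1})$. Equivalently, every $x\in S$ has a unique inverse, i.e. a unique $y\in S$ with $xyx=x$ and $yxy=y$. The center of $S$ is $Z(S)=\{x\in S: xy=yx \text{ for all } y\in S\}$. The commuting graph $\mathcal{G}(S)$ of a finite non-commutative semigroup $S$ is the simple graph with vertex set $S\setminus Z(S)$ in which two distinct vertices $x,y$ are adjacent if and only if $xy=yx$. The girth of a simple graph containing cycles is the length (number of edges) of a shortest cycle. *)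

(* Defs.v *)
From HB Require Import structures.
From mathcomp Require Import all_boot.

Set Implicit Arguments.
Unset Strict Implicit.
Unset Printing Implicit Defensive.

Local Open Scope group_scope.

(* MathComp's [x^-1] belongs to structures with a unit, which an inverse
   semigroup need not have, hence a separate inversion [invs]. *)
HB.mixin Record Semigroup_isInverse S of Semigroup S := {
  invs : S -> S;
  invsK : forall x : S, invs (invs x) = x;
  mulsVs : forall x : S, x * invs x * x = x;
  invsM : forall x y : S, invs (x * y) = invs y * invs x;
  mulsV_comm : forall x y : S,
    (x * invs x) * (y * invs y) = (y * invs y) * (x * invs x)
}.

#[short(type="finInverseSemigroupType")]
HB.structure Definition FinInverseSemigroup :=
  {S of Semigroup_isInverse S & Semigroup S & Finite S}.

Section CommutingGraph.
Variable S : finInverseSemigroupType.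

Definition center : {set S} := [set x | [forall y, x * y == y * x]].

Definition noncentral : finType := {x : S | x \notin center}.

Definition commuting_graph : rel noncentral :=
  fun x y => (x != y) && (val x * val y == val y * val x).

End CommutingGraph.

Section Girth.
Variables (T : finType) (e : rel T).

(* For an irreflexive symmetric [e], [ucycle] alone would also accept the empty
   sequence and the two ends of an edge; the size bound excludes them. *)
Definition graph_cycle (c : seq T) : bool := (2 < size c) && ucycleb e c.

Definition has_cycle_of_length (n : nat) : bool :=
  [exists c : n.-tuple T, graph_cycle c].

Definition contains_cycle : Prop := exists c : seq T, graph_cycle c.

Lemma contains_cycle_length :
  contains_cycle -> exists n, has_cycle_of_length n.
Proof. by case=> c cP; exists (size c); apply/existsP; exists (in_tuple c). Qed.

Definition girth (hc : contains_cycle) : nat :=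
  ex_minn (contains_cycle_length hc).

End Girth.

(* Main.v *)
(*
   Suppose that there is no triangle; the vertices of a cycle form a set C in
   which every element commutes with two others. Write e = u^-1 u, p = u u^-1.

   If e = p for every u, all idempotents are central. For x in C the inverse of
   x commutes with everything that x does, which forces x = x^-1. An x in C is a
   noncentral involution of a nonabelian maximal subgroup, which contains some
   noncentral g <> g^-1. If x, y in C are adjacent and in different subgroups,
   one of them forms a triangle with such a g and g^-1 from the subgroup of the
   other. If they are in the same subgroup, then x y is central and y = x c with
   c central; two neighbours of x of this form commute, a contradiction.

   If e <> p for some u, finiteness makes e and p noncentral, so a noncentral
   element commuting with both is e or p. One deduces that u is isolated, so C
   consists of elements x with x x^-1 = x^-1 x, that e and p are not in C, and
   that every x in C conjugates e and p into each other. Products of two elements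
   of C then commute with e and p, so they are central, and C is commutative.
*)
Require Import Defs.
From mathcomp Require Import all_boot.

Set Implicit Arguments.
Unset Strict Implicit.
Unset Printing Implicit Defensive.

Local Open Scope group_scope.

Local Notation "x ^V" := (invs x) (at level 3, format "x ^V").

(** * Idempotents, domains and ranges in inverse semigroups *)

Section InverseSemigroup.
Variable S : finInverseSemigroupType.
Implicit Types e f h t u v w x y z : S.

(* [dom] and [ran] are locked so that rewriting with [mulgA] does not look
   inside them. *)
Definition ran x := locked (x * x^V).
Definition dom x := locked (x^V * x).
Definition idem e := e * e = e.

Lemma ranE x : ran x = x * x^V. Proof. by rewrite /ran -lock. Qed.
Lemma domE x : dom x = x^V * x. Proof. by rewrite /dom -lock. Qed.

Lemma ranV x : ran x^V = dom x. Proof. by rewrite ranE domE invsK. Qed.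
Lemma domV x : dom x^V = ran x. Proof. by rewrite ranE domE invsK. Qed.

Lemma mul_ran x : ran x * x = x. Proof. by rewrite ranE mulsVs. Qed.
Lemma mul_dom x : x * dom x = x. Proof. by rewrite domE mulgA mulsVs. Qed.
Lemma mul_domV x : dom x * x^V = x^V. Proof. by rewrite -ranV mul_ran. Qed.
Lemma mul_ranV x : x^V * ran x = x^V. Proof. by rewrite -domV mul_dom. Qed.

Lemma ran_idem x : idem (ran x).
Proof. by rewrite /idem {2}ranE (mulgA (ran x)) mul_ran -ranE. Qed.

Lemma dom_idem x : idem (dom x).
Proof. by rewrite -ranV; apply: ran_idem. Qed.

Lemma idemV e : idem e -> e^V = e.
Proof.
move=> ee; have eV : e^V * e^V = e^V by rewrite -invsM ee.
have := mulsV_comm e^V e; rewrite invsK.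
rewrite mulgA -(mulgA _ e e) ee -(domE e) mul_domV => ->.
by rewrite domE mulgA -(mulgA e) eV mulsVs.
Qed.

Lemma idem_ran e : idem e -> ran e = e.
Proof. by move=> ee; rewrite ranE idemV. Qed.

Lemma idem_comm e f : idem e -> idem f -> commute e f.
Proof.
by move=> ee ff; have := mulsV_comm e f; rewrite -!ranE !idem_ran.
Qed.

Lemma ranM x y : ran (x * y) = x * ran y * x^V.
Proof. by rewrite !ranE invsM !mulgA. Qed.

Lemma domM x y : dom (x * y) = y^V * dom x * y.
Proof. by rewrite !domE invsM !mulgA. Qed.

Lemma ran_idemr x e : idem e -> ran (x * e) = x * e * x^V.
Proof. by move=> ee; rewrite ranM idem_ran. Qed.

Lemma dom_idemr x e : idem e -> dom (x * e) = dom x * e.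
Proof.
move=> ee; rewrite domM idemV // (idem_comm ee (dom_idem x)).
by rewrite -mulgA ee.
Qed.

Lemma commuteV x y : commute x y -> commute x^V y^V.
Proof. by rewrite /commute -!invsM => ->. Qed.

Lemma commuteMl x y z : commute x z -> commute y z -> commute (x * y) z.
Proof. by move=> xz yz; apply/commute_sym/commuteM; apply: commute_sym. Qed.

(* Any restriction [u = x * e] lies in [S e]; if also [ran u = dom u] then it
   lies in [e S]. *)
Lemma ran_dom_idemr x e : idem e -> ran (x * e) = dom (x * e) ->
  e * x * e = x * e.
Proof.
move=> ee rd; rewrite -mulgA -{1}(mul_ran (x * e)) rd dom_idemr //.
rewrite mulgA (mulgA e (dom x)) (idem_comm ee (dom_idem x)) -(mulgA _ e e) ee.
by rewrite -dom_idemr // -rd mul_ran.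
Qed.

(** Inverting the identity obtained for [x^V] gives [e * x * e = e * x], to be compared with the one
    for [x]. *)
Lemma commute_idem x e : idem e -> ran (x * e) = dom (x * e) ->
  ran (x^V * e) = dom (x^V * e) -> commute x e.
Proof.
move=> ee /(ran_dom_idemr ee) xe /(ran_dom_idemr ee) /(congr1 (@invs S)).
by rewrite !invsM invsK idemV // mulgA xe.
Qed.

Lemma not_commute_idem x e : idem e -> ~ commute x e ->
  exists2 t, t = x \/ t = x^V & ran (t * e) != dom (t * e).
Proof.
move=> ee xe; have [r1|] := eqVneq (ran (x * e)) (dom (x * e)); last first.
  by exists x; first left.
have [r2|] := eqVneq (ran (x^V * e)) (dom (x^V * e)); last first.
  by exists x^V; first right.
by case: xe; apply: commute_idem.
Qed.

Lemma idemM e f : idem e -> idem f -> idem (e * f).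
Proof.
move=> ee ff; rewrite /idem mulgA -(mulgA e f e) -(idem_comm ee ff) mulgA ee.
by rewrite -mulgA ff.
Qed.

Lemma idem_belowr x e : idem e -> x * e = e -> e * x = e.
Proof.
move=> ee xe; have eE : x * e * x^V = e by rewrite -ran_idemr // xe idem_ran.
rewrite -{1}eE -!mulgA -(domE x) (idem_comm ee (dom_idem x)).
by rewrite mulgA mul_dom.
Qed.

Lemma idem_belowl x e : idem e -> e * x = e -> x * e = e.
Proof.
move=> ee /(congr1 (@invs S)); rewrite invsM (idemV ee) => /(idem_belowr ee).
by move/(congr1 (@invs S)); rewrite invsM invsK (idemV ee).
Qed.

Lemma centerP x : reflect (forall y, commute x y) (x \in center S).
Proof. by rewrite inE; apply: (iffP forallP) => xC y; apply/eqP/xC. Qed.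

Lemma centerM x y : x \in center S -> y \in center S -> x * y \in center S.
Proof.
by move=> /centerP xC /centerP yC; apply/centerP=> z; apply: commuteMl.
Qed.

Lemma centerV x : (x^V \in center S) = (x \in center S).
Proof.
have cV t : t \in center S -> t^V \in center S.
  by move=> /centerP tC; apply/centerP=> y; rewrite -[y]invsK; apply: commuteV.
by apply/idP/idP=> [/cV|/cV //]; rewrite invsK.
Qed.

Lemma notin_centerP x : reflect (exists y, ~ commute x y) (x \notin center S).
Proof.
rewrite inE negb_forall; apply: (iffP existsP) => -[y xy]; exists y; exact/eqP.
Qed.

(* Left multiplication by [u] is injective on [dom u S] and maps it into itself,
   so by finiteness it reaches [dom u]. *)
Lemma dom_absorb u : dom u * u = u -> ran u = dom u.
Proof.
move=> eu; set e := dom u in eu *.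
pose A := [set s : S | e * s == s].
have inj : {in A &, injective ( *%g u)}.
  move=> s t; rewrite !inE => /eqP es /eqP et /(congr1 ( *%g u^V)).
  by rewrite !mulgA -!(domE u) -/e es et.
have im : [set u * s | s in A] = A.
  apply/eqP; rewrite eqEcard (card_in_imset inj) leqnn andbT.
  by apply/subsetP=> _ /imsetP[s _ ->]; rewrite inE mulgA eu.
have : e \in A by rewrite inE; apply/eqP/dom_idem.
rewrite -im => /imsetP[s _ es].
have re : ran u * e = e by rewrite es mulgA mul_ran.
rewrite -re (idem_comm (ran_idem u) (dom_idem u)) -/e.
by rewrite ranE mulgA eu.
Qed.

Lemma ran_absorb u : u * ran u = u -> ran u = dom u.
Proof.
move=> /(congr1 (@invs S)) ue; symmetry; rewrite -ranV -(domV u).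
by apply: dom_absorb; rewrite domV -[RHS]ue invsM (idemV (ran_idem u)).
Qed.

Lemma dom_central u : dom u \in center S -> ran u = dom u.
Proof. by move/centerP=> c; apply: dom_absorb; rewrite c mul_dom. Qed.

Lemma ran_central u : ran u \in center S -> ran u = dom u.
Proof. by move/centerP=> c; apply: ran_absorb; rewrite -c mul_ran. Qed.

Definition triangle_free := forall x y z,
  x \notin center S -> y \notin center S -> z \notin center S ->
  commute x y -> commute x z -> commute y z -> [|| x == y, x == z | y == z].

(* What is retained of the vertex set of a cycle. *)
Definition cyclic_set (C : pred S) := forall x, C x -> x \notin center S /\
  exists y z, [/\ C y, C z, y != z, y != x & z != x] /\
    (commute x y /\ commute x z).

Section TriangleFree.
Hypothesis tf : triangle_free.
Variable C : pred S.
Hypothesis cyc : cyclic_set C.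

(** * The case of central idempotents *)

Section Clifford.
Hypothesis cliff : forall x, ran x = dom x.

Lemma clifford_idem_central e : idem e -> e \in center S.
Proof.
by move=> ee; apply/centerP=> x; apply/commute_sym/commute_idem.
Qed.

Lemma ran_center x : ran x \in center S.
Proof. exact/clifford_idem_central/ran_idem. Qed.

Lemma clifford_commuteV x w : commute x w -> commute x^V w.
Proof.
move=> xw; have /centerP rC := ran_center x.
rewrite /commute -{1}mul_ranV -mulgA rC.
rewrite {1}ranE !mulgA -(mulgA _ w x) -xw mulgA -(domE x) -cliff rC.
by rewrite -mulgA cliff mul_domV.
Qed.

(* [p] and [x] have two common neighbours, which do not commute, as otherwise
   they would form a triangle with [x]. *)
Lemma cyclic_absorb x p : C x -> p \notin center S ->
  (forall w, commute x w -> commute p w) -> p = x.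
Proof.
move=> Cx pC pcomm; have [xC [y [z [[Cy Cz yz yx zx] [xy xz]]]]] := cyc Cx.
have [yC _] := cyc Cy; have [zC _] := cyc Cz.
have px : commute p x by apply: pcomm.
have py := pcomm _ xy; have pz := pcomm _ xz.
have := tf pC xC yC px py xy; have := tf pC xC zC px pz xz.
rewrite (eq_sym x z) (negPf zx) (eq_sym x y) (negPf yx) !orbF.
by case: eqP => //= _ /eqP -> /eqP zy; rewrite zy eqxx in yz.
Qed.

Lemma cyclic_inv x : C x -> x^V = x.
Proof.
move=> Cx; apply: cyclic_absorb => // [|w]; last exact: clifford_commuteV.
by rewrite centerV; have [] := cyc Cx.
Qed.

Lemma cyclic_ran x w : C x -> ~ commute x w -> ran w * x = x.
Proof.
move=> Cx xw; have /centerP hC := ran_center w.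
apply: cyclic_absorb => // [|t xt].
  apply/notin_centerP; exists w => hxw; apply: xw.
  move: hxw; rewrite /commute hC -mulgA mul_ran => ->.
  by rewrite -hC mulgA -hC mul_ran.
by apply: commuteMl.
Qed.

(* If [w] does not commute with [x], then [v = ran x * w] does not either and
   lies in the maximal subgroup of [x]; as [x] is an involution, one of [v],
   [x * v] is not. *)
Lemma cyclic_companion x : C x ->
  exists2 g, ran g = ran x & g \notin center S /\ g != g^V.
Proof.
move=> Cx; have xV := cyclic_inv Cx.
have xx : x * x = ran x by rewrite ranE xV.
have /centerP eC := ran_center x.
have [/notin_centerP[w xw] _] := cyc Cx.
pose v := ran x * w.
have rv : ran v = ran x.
  rewrite ranM idemV; last exact: ran_idem.
  by rewrite -mulgA -eC mulgA ran_idem eC (ranE x) mulgA cyclic_ran.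
have xv : x * v <> v * x.
  by rewrite /v mulgA -(eC x) mul_ran eC -mulgA mul_ran.
have vC : v \notin center S by apply/notin_centerP; exists x => /esym.
have [vV|] := eqVneq v v^V; last by exists v.
exists (x * v); first by rewrite ranM rv -eC mul_ran -ranE.
split.
  apply/notin_centerP; exists x => xvx; apply: xv.
  have vE : x * (x * v) = v by rewrite mulgA xx /v mulgA ran_idem.
  by rewrite -[in RHS]vE -mulgA xvx vE.
by apply/eqP; rewrite invsM xV -vV.
Qed.

(** If [ran y * x] is noncentral, [cyclic_absorb] applies. If it is central, [x] commutes with the
    companion [g] of [y], and [x], [g], [g^V] would form a triangle. *)
Lemma cyclic_adjacent_ran x y : C x -> C y -> commute x y -> ran y * x = x.
Proof.
move=> Cx Cy xy; have /centerP fC := ran_center y.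
have [fxC|fxC] := boolP (ran y * x \in center S); last first.
  by apply: cyclic_absorb => // w xw; apply: commuteMl.
have [g rg [gC gV]] := cyclic_companion Cy.
have xg : commute x g.
  rewrite /commute -{1}(mul_ran g) rg mulgA -(fC x).
  by move/centerP: fxC => ->; rewrite fC mulgA -fC -rg mulgA mul_ran.
have gVC : g^V \notin center S by rewrite centerV.
have xgV : commute x g^V by apply/commute_sym/clifford_commuteV/commute_sym.
have ggV : commute g g^V by rewrite /commute -ranE -domE.
have [xC _] := cyc Cx.
have /or3P[/eqP E|/eqP E|/eqP E] := tf xC gC gVC xg xgV ggV.
- by rewrite -E !(cyclic_inv Cx) eqxx in gV.
- by rewrite -[g]invsK -E !(cyclic_inv Cx) eqxx in gV.
- by rewrite -E eqxx in gV.
Qed.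

(** Otherwise [x * y] equals [x] or [y]; cancelling inside the common subgroup makes the other
    factor a central idempotent. *)
Lemma cyclic_adjacent_mul x y : C x -> C y -> x != y -> commute x y ->
  x * y \in center S.
Proof.
move=> Cx Cy neq xy; have [xC _] := cyc Cx; have [yC _] := cyc Cy.
apply: contraT => xyC.
have xxy : commute x (x * y) by apply: commuteM.
have yxy : commute y (x * y) by apply: commuteM => //; apply: commute_sym.
have /or3P[/eqP E|/eqP E|/eqP E] := tf xC yC xyC xy xxy yxy.
- by rewrite E eqxx in neq.
- move: yC; rewrite -(cyclic_adjacent_ran Cy Cx) ?cliff;
    last exact: commute_sym.
  by rewrite domE -mulgA -E -(domE x) -cliff ran_center.
- move: xC; rewrite -(cyclic_adjacent_ran Cx Cy) //.
  have /centerP fC := ran_center y.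
  by rewrite fC ranE mulgA -E -(ranE y) ran_center.
Qed.

Lemma clifford_cyclic_empty x : ~ C x.
Proof.
move=> Cx; have [xC [y [z [[Cy Cz yz yx zx] [xy xz]]]]] := cyc Cx.
have [yC _] := cyc Cy; have [zC _] := cyc Cz.
have xprod t : C t -> t != x -> commute x t ->
    exists2 c, c \in center S & t = x * c.
  move=> Ct tx xt; exists (x * t).
    by apply: cyclic_adjacent_mul; rewrite // eq_sym.
  rewrite mulgA -{1}(cyclic_inv Cx) -(domE x) -cliff.
  by rewrite (cyclic_adjacent_ran Ct Cx) //; apply: commute_sym.
have [c /centerP cC yE] := xprod _ Cy yx xy.
have [d /centerP dC zE] := xprod _ Cz zx xz.
have yzc : commute y z.
  rewrite yE zE; apply: commuteMl => //; apply: commuteM => //.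
  exact/commute_sym/dC.
have := tf xC yC zC xy xz yzc.
by rewrite (eq_sym x) (negPf yx) (eq_sym x) (negPf zx) (negPf yz).
Qed.

End Clifford.

(** * The case of an element with distinct domain and range *)

Section NonClifford.
Variable u : S.
Hypothesis ru : ran u != dom u.

Lemma dom_noncentral : dom u \notin center S.
Proof. by apply: contra ru => /dom_central/eqP. Qed.

Lemma ran_noncentral : ran u \notin center S.
Proof. by apply: contra ru => /ran_central/eqP. Qed.

Lemma commute_dom_ran x y : commute (dom x) (ran y).
Proof. by apply: idem_comm; [apply: dom_idem | apply: ran_idem]. Qed.

Lemma dom_not_below : dom u * ran u <> dom u.
Proof.
move=> ep; case/eqP: ru; apply: ran_absorb.
by rewrite -{1}(mul_dom u) -mulgA ep mul_dom.
Qed.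

Lemma ran_not_below : dom u * ran u <> ran u.
Proof.
move=> ep; case/eqP: ru; apply: dom_absorb.
by rewrite -{2}(mul_ran u) mulgA ep mul_ran.
Qed.

Lemma noncentral_commute w : w \notin center S ->
  commute w (dom u) -> commute w (ran u) -> w = dom u \/ w = ran u.
Proof.
move=> wC we wp.
have := tf wC dom_noncentral ran_noncentral we wp (commute_dom_ran u u).
by rewrite (eq_sym (dom u)) (negPf ru) orbF => /orP[] /eqP ->; [left|right].
Qed.

Lemma noncentral_idem f : idem f -> f \notin center S ->
  f = dom u \/ f = ran u.
Proof.
by move=> ff fC; apply: noncentral_commute => //; apply: idem_comm => //;
  [apply: dom_idem | apply: ran_idem].
Qed.

Lemma dom_ran_central : dom u * ran u \in center S.
Proof.
apply: contraT => /noncentral_idem[].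
- exact: idemM (dom_idem u) (ran_idem u).
- by move/dom_not_below.
- by move/ran_not_below.
Qed.

(** Multiplying [g] by [dom u] amounts to multiplying it by the central element [dom u * ran u]. *)
Lemma corner_commute g : ran u * g = g -> g * ran u = g ->
  commute g (dom u) /\ commute g (ran u).
Proof.
move=> pg gp; split; last by rewrite /commute pg gp.
have /centerP zC := dom_ran_central.
rewrite /commute -{1}gp -mulgA -(commute_dom_ran u u) -zC -mulgA pg //.
Qed.

Lemma commute_both_absurd y : y \notin center S -> commute u y ->
  commute y (dom u) -> commute y (ran u) -> False.
Proof.
move=> yC uy ye yp; case/eqP: ru.
have [yE|yE] := noncentral_commute yC ye yp; rewrite {}yE in uy.
- by apply: dom_absorb; rewrite -uy mul_dom.
- by apply: ran_absorb; rewrite uy mul_ran.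
Qed.

Lemma nonclifford_isolated y : y \notin center S -> commute u y -> y = u.
Proof.
move=> yC uy; have absurd := commute_both_absurd yC uy.
have wE : y * ran u = u * y * u^V by rewrite ranE mulgA uy.
have vE : dom u * y = u^V * y * u by rewrite domE -mulgA uy mulgA.
have pw : ran u * (y * ran u) = y * ran u by rewrite wE !mulgA mul_ran.
have wp : y * ran u * ran u = y * ran u by rewrite -mulgA ran_idem.
have [we cwp] := corner_commute pw wp.
(* [y * ran u] and [dom u * y] lie in the local monoids of [ran u] and
   [dom u], so each is central or the local identity. *)
have wu : y * ran u * u = y * u by rewrite -mulgA mul_ran.
have /centerP zC := dom_ran_central.
have ee := dom_idem u; have pp := ran_idem u.
have [wC|wC] := boolP (y * ran u \in center S); last first.
  have [wD|wR] := noncentral_commute wC we cwp.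
    by case: dom_not_below; rewrite (commute_dom_ran u u) -{1}wD pw wD.
  have py : ran u * y = ran u by apply: idem_belowr.
  have ey : dom u * y = dom u by rewrite vE -mulgA -wu wR mul_ran -domE.
  have ye : y * dom u = dom u by apply: idem_belowl.
  by case: absurd; rewrite /commute ?ye ?ey ?wR ?py.
have vC : dom u * y \in center S.
  rewrite vE -mulgA -wu; move/centerP: (wC) => ->.
  by rewrite mulgA -(domE u) -pw mulgA centerM // dom_ran_central.
(* These idempotents are the domain of [y * ran u] and the range of [dom u * y], both now
   central. *)
have kC : dom y * ran u \in center S.
  by rewrite -dom_idemr // domE centerM ?centerV.
have lC : ran y * dom u \in center S.
  have -> : ran y * dom u = ran (dom u * y).
    by rewrite ranM idemV // (commute_dom_ran u y) -(mulgA (ran y)) ee.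
  by rewrite ranE centerM ?centerV.
have bp : dom y <> ran u.
  by move=> bE; move: kC; rewrite bE pp (negPf ran_noncentral).
have ae : ran y <> dom u.
  by move=> aE; move: lC; rewrite aE ee (negPf dom_noncentral).
have [ab|ab] := eqVneq (ran y) (dom y).
  case: absurd.
    move/centerP: lC => lC.
    rewrite /commute -{2}(mul_ran y) (mulgA (dom u) (ran y)).
    by rewrite (commute_dom_ran u y) lC ab (mulgA y (dom y)) mul_dom.
  move/centerP: kC => kC.
  rewrite /commute -{2}(mul_ran y) (mulgA (ran u) (ran y)).
  by rewrite ab -(commute_dom_ran y u) kC (mulgA y (dom y)) mul_dom.
have aC : ran y \notin center S by apply: contra ab => /ran_central/eqP.
have bC : dom y \notin center S by apply: contra ab => /dom_central/eqP.
have [bE|//] := noncentral_idem (dom_idem y) bC.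
have [//|aE] := noncentral_idem (ran_idem y) aC.
(* Now [y] and [u] share domain and range, so [u * y^V] lies in the subgroup with identity [ran u].
   It can only be [ran u], whence [u = y]. *)
have rg : ran (u * y^V) = ran u by rewrite ranM ranV bE mul_dom -ranE.
have dg : dom (u * y^V) = ran u by rewrite domM invsK -bE mul_dom -ranE.
have gC : u * y^V \notin center S.
  by apply: contra ran_noncentral => gC; rewrite -rg ranE centerM ?centerV.
have [||ge gp] := @corner_commute (u * y^V).
- by rewrite -{1}rg mul_ran.
- by rewrite -{1}dg mul_dom.
have [gE|gE] := noncentral_commute gC ge gp.
  by case/eqP: ru; rewrite -rg gE idem_ran.
by rewrite -[RHS]mul_dom -bE domE mulgA gE -aE mul_ran.
Qed.

(** Both idempotents are noncentral, hence [dom u] and [ran u] in some order; the domain lies below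
    [ran u], which fixes the order. *)
Lemma restriction_ran t : ran (t * ran u) != dom (t * ran u) ->
  dom (t * ran u) = ran u /\ ran (t * ran u) = dom u.
Proof.
move=> rd; have pp := ran_idem u.
have [rC dC] :
  ran (t * ran u) \notin center S /\ dom (t * ran u) \notin center S.
  by split; apply: contra rd; [move/ran_central/eqP | move/dom_central/eqP].
have dE : dom (t * ran u) = ran u.
  have [dE|//] := noncentral_idem (dom_idem _) dC.
  by case: dom_not_below; rewrite -dE dom_idemr // -mulgA pp.
split=> //; have [//|rE] := noncentral_idem (ran_idem _) rC.
by rewrite rE dE eqxx in rd.
Qed.

(** Such a [y] does not commute with [ran u], so [y] or [y^V] conjugates [ran u] to [dom u]. As it
    also commutes with [dom u], this puts [ran u] below [dom u]. *)
Lemma commute_dom_absurd y : y \notin center S -> commute y (dom u) ->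
  y != dom u -> y != ran u -> False.
Proof.
move=> yC ye yne ynp; have ee := dom_idem u; have pp := ran_idem u.
have [t tE rd] : exists2 t, t = y \/ t = y^V &
    ran (t * ran u) != dom (t * ran u).
  apply: not_commute_idem => // yp.
  by have [E|E] := noncentral_commute yC ye yp; rewrite E eqxx in yne ynp.
have te : commute t (dom u).
  by case: tE => -> //; rewrite -(idemV ee); apply: commuteV.
have [] := restriction_ran rd; rewrite dom_idemr // ran_idemr // => dE rE.
case: ran_not_below.
have pE : dom t * dom u = ran u.
  rewrite {1}domE -mulgA te -{1}rE !mulgA -(domE t) dE -mulgA -(domE t).
  by rewrite -(commute_dom_ran t u).
by rewrite -pE mulgA (idem_comm ee (dom_idem t)) -mulgA ee.
Qed.
End NonClifford.

(** Conjugation by [x] exchanges [dom u] and [ran u], both of which lie below [dom x]. *)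
Definition swaps u x := [/\ x * dom u = ran u * x, x * ran u = dom u * x,
  dom x * dom u = dom u & dom x * ran u = ran u].

Lemma swapsV u x : swaps u x -> swaps u^V x.
Proof. by rewrite /swaps ranV domV => -[]. Qed.

Section Swaps.
Variable u : S.
Hypothesis ru : ran u != dom u.

Let ruV : ran u^V != dom u^V.
Proof. by rewrite ranV domV eq_sym. Qed.

Lemma swaps_restriction t : ran t = dom t ->
  ran (t * dom u) != dom (t * dom u) -> swaps u t.
Proof.
have ee := dom_idem u; have pp := ran_idem u.
move=> ab; have := @restriction_ran _ ruV t.
rewrite ranV domV => /[apply] -[].
rewrite dom_idemr // ran_idemr // => be pE.
have bp : dom t * ran u = ran u by rewrite -ab -{1}pE !mulgA mul_ran pE.
have te : t * dom u = ran u * t.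
  by rewrite -pE -!mulgA -(domE t) (idem_comm ee (dom_idem t)) be.
have dp : dom (t * ran u) = ran u by rewrite dom_idemr.
have rC : ran (t * ran u) \notin center S.
  apply: contra (ran_noncentral ru) => rC.
  by rewrite -dp -(ran_central rC).
have [rE|rE] := noncentral_idem ru (ran_idem _) rC; last first.
  (* Here [t] would conjugate both [dom u] and [ran u] to [ran u]; conjugating back identifies
     them. *)
  move: rE; rewrite ran_idemr // -[RHS]pE => /(congr1 (fun s => t^V * s * t)).
  rewrite !mulgA -!(domE t) bp be -!mulgA -!(domE t).
  rewrite -(commute_dom_ran t u) bp (idem_comm ee (dom_idem t)) be => E.
  by case/eqP: ru; rewrite E.
split=> //; rewrite -rE ran_idemr // -!mulgA -(domE t).
by rewrite -(commute_dom_ran t u) bp.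
Qed.

Lemma clifford_swaps x : ran x = dom x -> ~ commute x (dom u) -> swaps u x.
Proof.
move=> ab /(not_commute_idem (dom_idem u))[t [] -> rd].
  exact: swaps_restriction.
have [] := swaps_restriction _ rd; first by rewrite ranV domV.
rewrite domV ab => te tp be bp; split=> //.
  by move/(congr1 (@invs S)): tp; rewrite !invsM invsK !idemV //;
    [apply: dom_idem | apply: ran_idem].
by move/(congr1 (@invs S)): te; rewrite !invsM invsK !idemV //;
  [apply: ran_idem | apply: dom_idem].
Qed.

(** Otherwise [x * dom u * y = dom u * ran u]. Undoing [x] and [y] makes [dom u] a multiple of this
    central idempotent, hence below [ran u]. *)
Lemma swaps_mul_neq x y : ran y = dom y -> swaps u x -> swaps u y ->
  x * y <> dom u.
Proof.
move=> ab [xe xp be bp] [ye yp b'e b'p] xyE.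
have /centerP zC := dom_ran_central ru.
apply: (dom_not_below ru); rewrite (commute_dom_ran u u).
suff E : dom u = dom u * ran u * (x^V * y^V).
  rewrite [in LHS]E (commute_dom_ran u u) !mulgA ran_idem.
  by rewrite -(commute_dom_ran u u) -mulgA -E.
have E : x * (dom u * y) = dom u * ran u by rewrite -yp mulgA xyE.
have := congr1 (fun s => x^V * s * y^V) E.
rewrite !mulgA -(domE x) be -(mulgA (dom u) y) -(ranE y) ab.
rewrite (idem_comm (dom_idem u) (dom_idem y)) b'e => {1}->.
by rewrite -(mulgA x^V) -zC.
Qed.
End Swaps.

Lemma swaps_mul_central u x y : ran u != dom u -> ran y = dom y ->
  swaps u x -> swaps u y -> x * y \in center S.
Proof.
move=> ru ab sx sy; apply: contraT => xyC.
have [xe xp _ _] := sx; have [ye yp _ _] := sy.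
have cE : commute (x * y) (dom u) by rewrite /commute -mulgA ye mulgA xp mulgA.
have cP : commute (x * y) (ran u) by rewrite /commute -mulgA yp mulgA xe mulgA.
have [xyE|xyE] := noncentral_commute ru xyC cE cP.
  by case: (swaps_mul_neq ru ab sx sy).
have ruV : ran u^V != dom u^V by rewrite ranV domV eq_sym.
by case: (swaps_mul_neq ruV ab (swapsV sx) (swapsV sy)); rewrite domV.
Qed.

(** Centrality of [y * x] gives [y * (x * y) = y * (y * x)]. The left factor [y] cancels because
    [dom y] fixes both products. *)
Lemma swaps_commute u x y : ran u != dom u -> ran x = dom x -> ran y = dom y ->
  swaps u x -> swaps u y -> commute x y.
Proof.
move=> ru rx ry sx sy.
have /centerP cC := swaps_mul_central ru ry sx sy.
have /centerP dC := swaps_mul_central ru rx sy sx.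
have E : y * (x * y) = y * (y * x) by rewrite mulgA dC.
rewrite /commute -{1}(mul_dom y) mulgA cC domE -mulgA E mulgA -domE -ry.
by rewrite mulgA mul_ran.
Qed.

Lemma cyclic_clifford x : C x -> ran x = dom x.
Proof.
move=> Cx; have [_ [y [_ [[Cy _ _ yx _] [xy _]]]]] := cyc Cx.
have [yC _] := cyc Cy; apply/eqP; apply: contraT => rx.
by rewrite (nonclifford_isolated rx yC xy) eqxx in yx.
Qed.

(** One of two distinct neighbours of [dom u] differs from [ran u]. *)
Lemma cyclic_dom u : ran u != dom u -> ~ C (dom u).
Proof.
move=> ru Ce; have [_ [y [z [[Cy Cz yz ye ze] [ey ez]]]]] := cyc Ce.
have [yC _] := cyc Cy; have [zC _] := cyc Cz.
have [yE|yp] := eqVneq y (ran u).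
  by apply: (commute_dom_absurd ru zC) => //; rewrite -yE eq_sym.
by apply: (commute_dom_absurd ru yC).
Qed.

Lemma cyclic_swaps u x : ran u != dom u -> C x -> swaps u x.
Proof.
move=> ru Cx; have [xC _] := cyc Cx.
apply: clifford_swaps => // [|xe]; first exact: cyclic_clifford.
apply: (commute_dom_absurd ru xC) => //; apply/eqP => xE.
  by apply: (cyclic_dom ru); rewrite -xE.
by apply: (@cyclic_dom u^V); rewrite ?ranV ?domV ?(eq_sym _ (ran u)) // -xE.
Qed.

Lemma nonclifford_cyclic_empty u x : ran u != dom u -> ~ C x.
Proof.
move=> ru Cx; have [xC [y [z [[Cy Cz yz yx zx] [xy xz]]]]] := cyc Cx.
have [yC _] := cyc Cy; have [zC _] := cyc Cz.
have yzc : commute y z.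
  by apply: (swaps_commute ru); rewrite ?cyclic_clifford //;
    apply: cyclic_swaps.
have := tf xC yC zC xy xz yzc.
by rewrite (eq_sym x) (negPf yx) (eq_sym x) (negPf zx) (negPf yz).
Qed.

Lemma triangle_free_cyclic_empty x : ~ C x.
Proof.
have [/forallP cliff|/forallPn[u]] := boolP [forall t, ran t == dom t].
  by apply: clifford_cyclic_empty => t; apply/eqP.
exact: nonclifford_cyclic_empty.
Qed.
End TriangleFree.
End InverseSemigroup.

(** * Passage between graph cycles and elements of the semigroup *)

Lemma cycle_cyclic_set (S : finInverseSemigroupType) (c : seq (noncentral S)) :
  graph_cycle (@commuting_graph S) c -> cyclic_set [pred x | x \in map val c].
Proof.
case/andP=> c_gt2 /andP[cc uc] _ /= /mapP[x xc ->].
split; first exact: (valP x).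
(* Once the cycle is rotated to start at [x], the second and last vertices are the two neighbours;
   length above 2 keeps them distinct. *)
case: (rot_to xc) => i s rE.
have : cycle (@commuting_graph S) (x :: s) by rewrite -rE rot_cycle.
have : uniq (x :: s) by rewrite -rE rot_uniq.
have memE t : (t \in c) = (t \in x :: s) by rewrite -rE mem_rot.
have : 2 < size (x :: s) by rewrite -rE size_rot.
case: s rE memE => [|y s] // _ memE; case: (lastP s) memE => [|{}s z] // memE _.
rewrite /= rcons_path last_rcons => /and3P[xn yn _].
case/and3P=> /andP[_ /eqP xy] _ /andP[_ /eqP zx].
move: xn yn; rewrite !inE !mem_rcons !inE !negb_or.
move=> /and3P[xNy xNz _] /andP[yNz _].
exists (val y), (val z).
split; last by split=> //; apply/esym.
split; rewrite ?(inj_eq val_inj) //= 1?eq_sym //.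
- by apply: map_f; rewrite memE !inE eqxx orbT.
- by apply: map_f; rewrite memE !inE mem_rcons !inE eqxx !orbT.
Qed.

Lemma no_triangle_free (S : finInverseSemigroupType) :
  ~~ has_cycle_of_length (@commuting_graph S) 3 -> triangle_free S.
Proof.
move=> nc x y z xC yC zC xy xz yz; apply: contraR nc.
rewrite !negb_or => /and3P[xNy xNz yNz].
pose X : noncentral S := Sub x xC; pose Y : noncentral S := Sub y yC.
pose Z : noncentral S := Sub z zC.
apply/existsP; exists [tuple X; Y; Z].
rewrite /graph_cycle /ucycleb /= !inE /commuting_graph -!(inj_eq val_inj) /=.
rewrite xy yz -xz !eqxx xNy yNz (eq_sym z x) negb_or xNy xNz /=.
by [].
Qed.

Theorem theorem3p4 (S : finInverseSemigroupType)
  (hnc : ~ (forall x y : S, commute x y))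
  (hc : contains_cycle (@commuting_graph S)) :
  girth hc = 3.
Proof.
rewrite /girth; case: ex_minnP => n hn nmin; apply/eqP.
rewrite eqn_leq; apply/andP; split; last first.
  by case/existsP: hn => c /andP[]; rewrite size_tuple.
apply: nmin; apply: contraT => /no_triangle_free tf.
have [c cP] := hc; have [c_gt2 _] := andP cP.
case: c cP c_gt2 => // x c cP _.
case: (triangle_free_cyclic_empty tf (cycle_cyclic_set cP) (x := val x)).
by rewrite /= mem_head.
Qed.
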